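(* Let $M$ be a ground conjunctive Markov logic network and let $C$ be a $\sim_M$-equivalence class. Deciding whether $C=\emptyset$ can be done in polynomial time.
   Context: A ground conjunctive Markov logic network (ground cMLN) is a finite list $M$ of pairs $(F_j,w_j)$, where each $F_j$ is a conjunction of ground atoms and $w_j\in\mathbb R$, over a finite set $X$ of ground atoms (the Herbrand base). A (possible) world is a truth assignment $\lambda:X\to\{0,1\}$. $Sat(\lambda,M)$ is the set of formulas of $M$ satisfied by $\lambda$. Worlds $\lambda_1,\lambda_2$ are equivalent, $\lambda_1\sim_M\lambda_2$, iff $Sat(\lambda_1,M)=Sat(\lambda_2,M)$. A ''$\sim_M$-equivalence class'' is specified by choosing which formulas of $M$ are true and which are false: for each subset $T$ of the formulas of $M$, the class is $C=\{\lambda : Sat(\lambda,M)=T\}$, described by the formula $\bigwedge_{F\in T}F\wedge\bigwedge_{F\in M\setminus T}\neg F$. There are $2^{|M|}$ classes in this sense ($|M|$ the number of formulas), and some may be empty. The class $C$ is given as input in this form. *)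

(* Defs.v *)
From mathcomp Require Import all_boot all_order all_algebra.
From mathcomp Require Import finmap reals.

Set Implicit Arguments.
Unset Strict Implicit.
Unset Printing Implicit Defensive.

Local Open Scope ring_scope.

(** * Deterministic multi-tape Turing machines and polynomial time *)

Inductive move := Left | Stay | Right.

Section Machine.
Variable S : finType.

(* [None] is the blank; input words contain neither blanks nor work symbols. *)
Definition cell (W : finType) : finType := option (S + W)%type.

Record machine := Machine {
  state : finType;
  work : finType;
  ntapes : nat;
  start : state;
  accept : state;
  reject : state;
  accept_neq_reject : accept != reject;
  trans : state -> (ntapes.+1).-tuple (cell work) ->
          state * (ntapes.+1).-tuple (cell work * move)
}.

Section Tape.
Variable W : finType.

(* A two-way infinite tape: the cells strictly to the left of the head, nearest
   first, then the cells from the head rightwards; cells beyond either list are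
   blank. *)
Definition tape : Type := (seq (cell W) * seq (cell W))%type.

Definition read (t : tape) : cell W := head None t.2.

Definition write (c : cell W) (t : tape) : tape := (t.1, c :: behead t.2).

Definition shift (m : move) (t : tape) : tape :=
  match m with
  | Left => (behead t.1, head None t.1 :: t.2)
  | Stay => t
  | Right => (read t :: t.1, behead t.2)
  end.

End Tape.

Variable M : machine.

Definition config : Type :=
  (state M * ((ntapes M).+1).-tuple (tape (work M)))%type.

(* The input is on the first tape, with the head on its first symbol. *)
Definition init (w : seq S) : config :=
  (start M,
   [tuple if i == ord0 then ([::], [seq Some (inl s) | s <- w])
          else ([::], [::]) | i < (ntapes M).+1]).

Definition step (c : config) : config :=
  if (c.1 == accept M) || (c.1 == reject M) then c else
  let: (q, a) := trans c.1 (map_tuple (@read (work M)) c.2) in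
  (q, [tuple shift (tnth a i).2 (write (tnth a i).1 (tnth c.2 i))
      | i < (ntapes M).+1]).

(* Halted configurations are fixed by [step], so this says that [M] halts on
   [w] after at most [t] steps, with answer [b]. *)
Definition answers_within (t : nat) (w : seq S) (b : bool) : Prop :=
  (iter t step (init w)).1 = if b then accept M else reject M.

End Machine.

Definition poly_time_decidable (I : Type) (S : finType) (enc : I -> seq S)
    (P : pred I) : Prop :=
  exists (M : machine S) (p : {poly nat}),
    forall x : I, answers_within M p.[size (enc x)] (enc x) (P x).

(** * Ground conjunctive Markov logic networks *)

Section GroundCMLN.
(* Ground atoms are expressions, i.e. words over a finite alphabet [A]. *)
Variables (A : finType) (R : realType).

Definition atom := seq A.

Definition conjunction (X : {fset atom}) := seq X.

Definition ground_cMLN (X : {fset atom}) := seq (conjunction X * R).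

Definition world (X : {fset atom}) := {ffun X -> bool}.

Definition satisfies (X : {fset atom}) (l : world X) (F : conjunction X) : bool :=
  all l F.

Definition formula (X : {fset atom}) (M : ground_cMLN X) (j : 'I_(size M)) :
  conjunction X := (tnth (in_tuple M) j).1.

(* The formulas of [M] are referred to by their position in the list. *)
Definition Sat (X : {fset atom}) (l : world X) (M : ground_cMLN X) :
  {set 'I_(size M)} := [set j | satisfies l (formula j)].

Definition world_equiv (X : {fset atom}) (M : ground_cMLN X) : rel (world X) :=
  fun l1 l2 => Sat l1 M == Sat l2 M.

Definition eq_class (X : {fset atom}) (M : ground_cMLN X)
    (T : {set 'I_(size M)}) : {set world X} := [set l | Sat l M == T].

Lemma world_equivE (X : {fset atom}) (M : ground_cMLN X) (l1 l2 : world X) :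
  world_equiv M l1 l2 = (l2 \in eq_class (Sat l1 M)).
Proof. by rewrite inE /world_equiv eq_sym. Qed.

(* The formula /\_{F in T} F /\ /\_{F notin T} ~ F, as the list of the formulas
   of [M], each with the sign under which it occurs. *)
Definition description (X : {fset atom}) (M : ground_cMLN X)
    (T : {set 'I_(size M)}) : seq (bool * seq atom) :=
  [seq (j \in T, [seq val a | a <- formula j]) | j <- enum 'I_(size M)].

Lemma eq_classP (X : {fset atom}) (M : ground_cMLN X) (T : {set 'I_(size M)})
    (l : world X) (v : pred atom) :
  (forall a : X, v (val a) = l a) ->
  (l \in eq_class T) = all (fun bF => all v bF.2 == bF.1) (description T).
Proof.
move=> vl; rewrite inE all_map.
have E j : all v [seq val a | a <- formula j] = (j \in Sat l M).
  by rewrite inE all_map; apply: eq_all => a; rewrite /= vl.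
apply/eqP/allP => [<- j _ /=|H]; first by rewrite E.
by apply/setP => j; rewrite -E; apply/eqP/H; rewrite mem_enum.
Qed.

(* [inl (inl b)] opens a formula of sign [b], [inl (inr tt)] opens an atom, and
   [inr x] is the letter [x] of an atom. *)
Definition symbol : finType := ((bool + unit) + A)%type.

Definition encode_atom (a : atom) : seq symbol :=
  inl (inr tt) :: [seq inr x | x <- a].

Definition encode_signed (bF : bool * seq atom) : seq symbol :=
  inl (inl bF.1) :: flatten [seq encode_atom a | a <- bF.2].

Definition encode (d : seq (bool * seq atom)) : seq symbol :=
  flatten [seq encode_signed bF | bF <- d].

Lemma encode_inj : injective encode.
Proof.
pose f (s : symbol) (z : atom * seq atom * seq (bool * seq atom)) :=
  let: (a, F, d) := z in
  match s with
  | inl (inl b) => ([::], [::], (b, F) :: d)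
  | inl (inr _) => ([::], a :: F, d)
  | inr x => (x :: a, F, d)
  end.
suff K d : foldr f ([::], [::], [::]) (encode d) = ([::], [::], d).
  by move=> d1 d2 e; have := K d1; rewrite e K => -[].
elim: d => // -[b F] d IH.
rewrite /encode /= foldr_cat -/(encode d) IH.
suff -> : foldr f ([::], [::], d) (flatten [seq encode_atom a | a <- F])
          = ([::], F, d) by [].
elim: F => // a F IHF; rewrite /= foldr_cat IHF.
by have -> : foldr f ([::], F, d) [seq inr x | x <- a] = (a, F, d)
  by elim: a => //= x a ->.
Qed.

Record class_instance := ClassInstance {
  base : {fset atom};
  network : ground_cMLN base;
  true_formulas : {set 'I_(size network)}
}.

(* The weights are real numbers and do not occur in the formula that describes a
   class, so they are not part of the input word. *)
Definition encode_instance (I : class_instance) : seq symbol :=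
  encode (description (true_formulas I)).

End GroundCMLN.

(* Main.v *)
Require Import Defs.
From HB Require Import structures.
From mathcomp Require Import all_boot all_order all_algebra.
From mathcomp Require Import finmap reals.
From mathcomp Require Import zify.

(** The class described by a list of signed conjunctions is empty iff some
    negative conjunction has all its atoms among the atoms of the positive ones:
    otherwise the world whose true atoms are exactly those of the positive
    conjunctions lies in the class.  A two-tape machine tests this in quadratic
    time.  It copies the atoms of the positive conjunctions to the second tape;
    both heads are then at the right end, and the first one goes back to the left,
    looking up each atom on the second tape.  In this direction the sign of a
    conjunction is met after its atoms, when the machine already knows whether
    they were all found. *)

Set Implicit Arguments.
Unset Strict Implicit.
Unset Printing Implicit Defensive.

(** * Criterion for the emptiness of a class *)

Definition positive_atoms (X : Type) (d : seq (bool * seq X)) : seq X :=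
  flatten [seq bF.2 | bF <- d & bF.1].

Definition covered (X : eqType) (s : seq X) (bF : bool * seq X) : bool :=
  ~~ bF.1 && all (mem s) bF.2.

Lemma eq_class_eq0 (A : finType) (R : realType) (X : {fset atom A})
    (M : ground_cMLN R X) (T : {set 'I_(size M)}) :
  (eq_class T == set0) =
  has (covered (positive_atoms (description T))) (description T).
Proof.
set d := description T; apply/idP/idP; last first.
  case/hasP => -[b F] dF /andP[/= /negbTE b0 /allP posF]; subst b.
  apply/eqP/setP => l; rewrite [RHS]inE.
  (* [eq_classP] asks for a valuation of all words: [l] is extended by [false] outside the base. *)
  pose v (x : atom A) := if insub x is Some a then l a else false.
  have vl (a : X) : v (val a) = l a by rewrite /v valK.
  rewrite (eq_classP T vl) -/d; apply: contraTF dF => /allP satd.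
  apply/negP => dF; have := satd _ dF; rewrite /= eqbF_neg => /negP.
  apply; apply/allP => a /posF /flattenP[_ /mapP[[[] G] + ->]];
    rewrite mem_filter //= => dG.
  by move: (satd _ dG); rewrite /= eqb_id => /allP; apply.
apply: contraTT => /hasPn posd; apply/set0Pn.
exists [ffun a : X => val a \in positive_atoms d].
rewrite (@eq_classP _ _ _ _ _ _ (mem (positive_atoms d))); last first.
  by move=> a; rewrite ffunE.
apply/allP => -[b F] dF; have := posd _ dF; rewrite /covered /=.
case: b dF => [dF _ | dF]; last by rewrite eqbF_neg.
rewrite eqb_id; apply/allP => a Fa.
apply/flattenP; exists F => //; apply/mapP; exists (true, F) => //.
by rewrite mem_filter.
Qed.

(** * The machine: control states and transitions *)

Inductive mode := Start | Copy | Compare | Advance | Return | Skip | Rewind | Halt.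

Definition mode_code (m : mode) : 'I_8 :=
  match m with
  | Start => @Ordinal 8 0 isT | Copy => @Ordinal 8 1 isT
  | Compare => @Ordinal 8 2 isT | Advance => @Ordinal 8 3 isT
  | Return => @Ordinal 8 4 isT | Skip => @Ordinal 8 5 isT
  | Rewind => @Ordinal 8 6 isT | Halt => @Ordinal 8 7 isT
  end.

Definition mode_decode (i : 'I_8) : mode :=
  nth Halt [:: Start; Copy; Compare; Advance; Return; Skip; Rewind] i.

Lemma mode_codeK : cancel mode_code mode_decode.
Proof. by case. Qed.

HB.instance Definition _ := Finite.copy mode (can_type mode_codeK).

Section EmptinessMachine.
Variable A : finType.

Local Notation cell := (cell (symbol A) void).
Local Notation tape := (tape (symbol A) void).

Definition of_symbol (s : symbol A) : cell := Some (inl s).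
Definition letter (x : A) : cell := of_symbol (inr x).
Definition opener : cell := of_symbol (inl (inr tt)).
Definition sign (b : bool) : cell := of_symbol (inl (inl b)).

Definition is_letter (c : cell) : bool :=
  if c is Some (inl (inr _)) then true else false.

(* In mode [Copy] the flag is the sign of the current formula; from [Compare] on
   it says that all the atoms of the current formula read so far were found. *)
Definition control : finType := (bool * mode)%type.

(** After a mismatch, [Advance] takes the second head past the opener of its atom, and [Return]
    takes the first head back to the right end of the current atom. Once the answer for an atom is
    known, [Skip] takes the first head past it and [Rewind] takes the second head back to the right
    end of its tape. *)
Definition delta (q : control) (x y : cell) :
    control * ((cell * move) * (cell * move)) :=
  let: (b, m) := q in
  match m with
  (* The blank left at the left end of the second tape delimits it: no head goes
     further to the left. *)
  | Start => ((false, Copy), ((x, Stay), (None, Right)))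
  | Copy =>
      match x with
      | None => ((true, Compare), ((None, Left), (None, Left)))
      | Some (inl (inl (inl s))) => ((s, Copy), ((x, Right), (None, Stay)))
      | _ => ((b, Copy), ((x, Right), if b then (x, Right) else (None, Stay)))
      end
  | Compare =>
      match x, y with
      | None, _ => ((false, Halt), ((x, Stay), (y, Stay)))
      | Some (inl (inl (inl s))), _ =>
          if b && ~~ s then ((true, Halt), ((x, Stay), (y, Stay)))
          else ((true, Compare), ((x, Left), (y, Stay)))
      | _, None => ((false, Skip), ((x, Stay), (y, Right)))
      | _, _ =>
          if x == y then
            if is_letter x then ((b, Compare), ((x, Left), (y, Left)))
            else ((b, Skip), ((x, Stay), (y, Stay)))
          else ((b, Advance), ((x, Right), (y, Stay)))
      end
  | Advance =>
      if y == opener then ((b, Return), ((x, Stay), (y, Left)))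
      else ((b, Advance), ((x, Stay), (y, Left)))
  | Return =>
      if is_letter x then ((b, Return), ((x, Right), (y, Stay)))
      else ((b, Compare), ((x, Left), (y, Stay)))
  | Skip =>
      if x == opener then ((b, Rewind), ((x, Left), (y, Stay)))
      else ((b, Skip), ((x, Left), (y, Stay)))
  | Rewind =>
      if y is None then ((b, Compare), ((x, Stay), (y, Left)))
      else ((b, Rewind), ((x, Stay), (y, Right)))
  | Halt => (q, ((x, Stay), (y, Stay)))
  end.

Definition delta_tuple (q : control) (c : 2.-tuple cell) :
    control * 2.-tuple (cell * move) :=
  let: (q', (a, a')) := delta q (tnth c ord0) (tnth c ord_max) in
  (q', [tuple a; a']).

Lemma halt_neq : ((true, Halt) : control) != (false, Halt).
Proof. by []. Qed.

Definition emptiness_machine : machine (symbol A) :=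
  @Machine (symbol A) control void 1 (false, Start) (true, Halt) (false, Halt)
    halt_neq delta_tuple.

(** * Configurations and runs of bounded length *)

Local Notation EM := emptiness_machine.

Definition cfg (q : control) (t t' : tape) : config EM := (q, [tuple t; t']).

Lemma cfg_ext q (T : 2.-tuple tape) t t' :
  tnth T ord0 = t -> tnth T ord_max = t' -> (q, T) = cfg q t t' :> config EM.
Proof.
move=> <- <-; rewrite /cfg; congr pair; apply: eq_from_tnth => i.
case: i => -[|[|//]] i; rewrite /tnth /=; apply: set_nth_default;
  by rewrite size_tuple.
Qed.

Lemma init_cfg w :
  init EM w = cfg (false, Start) ([::], map of_symbol w) ([::], [::]).
Proof. by apply: (cfg_ext (false, Start)); rewrite tnth_mktuple. Qed.

Lemma step_cfg b m t t' : m != Halt ->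
  step (cfg (b, m) t t') =
  let: (q, (a, a')) := delta (b, m) (read t) (read t') in
  cfg q (shift a.2 (write a.1 t)) (shift a'.2 (write a'.1 t')).
Proof.
move=> mH; case E: (delta _ _ _) => [q [a a']].
have {}E : delta_tuple (b, m) (map_tuple (@read _ _) [tuple t; t']) =
    (q, [tuple a; a']) by rewrite /delta_tuple !tnth_map E.
rewrite /step /= !xpair_eqE (negbTE mH) !andbF E.
by apply: (cfg_ext q); rewrite tnth_mktuple.
Qed.

Definition reaches (n : nat) (c c' : config EM) : Prop :=
  exists2 k, k <= n & iter k (@step _ EM) c = c'.

Lemma reaches_refl n c : reaches n c c.
Proof. by exists 0. Qed.

Lemma reaches_step n c c' : reaches n (step c) c' -> reaches n.+1 c c'.
Proof. by case=> k kn <-; exists k.+1 => //; rewrite iterSr. Qed.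

Lemma reaches_trans m n c1 c2 c3 :
  reaches m c1 c2 -> reaches n c2 c3 -> reaches (m + n) c1 c3.
Proof.
by case=> i im <- [j jn <-]; exists (j + i); rewrite ?iterD // addnC leq_add.
Qed.

Lemma reaches_leq m n c c' : m <= n -> reaches m c c' -> reaches n c c'.
Proof. by move=> mn [k km ?]; exists k => //; apply: leq_trans mn. Qed.

(** * Tape contents in leftward order *)

(* The head is on the first element of [l], which is read leftwards. *)
Definition focus (l r : seq cell) : tape := (behead l, head None l :: r).

(* An atom as met by a head that moves to the left: [s] is the reversed atom. *)
Definition block (s : seq A) : seq cell := map letter s ++ [:: opener].
Definition blocks (F : seq (seq A)) : seq cell := flatten (map block F).

Lemma rev_block s : rev (block s) = opener :: rev (map letter s).
Proof. by rewrite rev_cat. Qed.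

Lemma size_block s : size (block s) = (size s).+1.
Proof. by rewrite size_cat size_map addn1. Qed.

Lemma blocks_cat F G : blocks (F ++ G) = blocks F ++ blocks G.
Proof. by rewrite /blocks map_cat flatten_cat. Qed.

Lemma None_block s : None \notin block s.
Proof. by rewrite mem_cat negb_or; apply/andP; split=> //; apply/mapP => -[]. Qed.

Lemma None_blocks F : None \notin blocks F.
Proof.
by elim: F => // s F; rewrite -cat1s blocks_cat mem_cat negb_or /blocks /= cats0
  None_block.
Qed.

Lemma letter_eq x y : (letter x == letter y) = (x == y).
Proof. by []. Qed.

(** * Looking up one atom on the second tape *)

Lemma reaches_advance b u z v s l r :
  reaches (size (block s)) (cfg (b, Advance) (u, z :: v) (focus (block s ++ l) r))
    (cfg (b, Return) (u, z :: v) (focus l (rev (block s) ++ r))).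
Proof.
elim: s r => [|x s IH] r; apply: reaches_step; rewrite step_cfg //=.
  exact: reaches_refl.
by rewrite rev_cons cat_rcons; apply: IH.
Qed.

(** The non-letter [y] tells the head that it has passed the last letter of its atom, so that it
    turns back. *)
Lemma reaches_return b s l y r u z v : ~~ is_letter y ->
  reaches (size s).+1
    (cfg (b, Return) (l, map letter s ++ y :: r) (u, z :: v))
    (cfg (b, Compare) (focus (rev (map letter s) ++ l) (y :: r)) (u, z :: v)).
Proof.
move=> /negbTE ny; elim: s l => [|x s IH] l; apply: reaches_step.
  by rewrite step_cfg //= /read /= ny; apply: reaches_refl.
by rewrite step_cfg //= rev_cons cat_rcons; apply: IH.
Qed.

(** [g] holds the letters already matched, which [Return] must cross again; generalising over it
    allows the induction on the common prefix of [s] and [s']. Since [s != s'], the heads disagree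
    at the latest when one of them meets an opener. *)
Lemma reaches_compare_neq b s s' g l y r l' r' : s != s' -> ~~ is_letter y ->
  reaches (2 * size s + size s' + size g + 4)
    (cfg (b, Compare) (focus (block s ++ l) (map letter g ++ y :: r))
       (focus (block s' ++ l') r'))
    (cfg (b, Compare) (focus (rev (map letter g) ++ block s ++ l) (y :: r))
       (focus l' (rev (block s') ++ r'))).
Proof.
move=> + /[dup] ny /negbTE ny'; elim: s s' g r' => [|x s IH] s' g r' ne.
all: have mismatch t t' :
  step (cfg (b, Compare) (focus (block t ++ l) (map letter g ++ y :: r))
    (focus (block t' ++ l') r')) =
  cfg (b, Advance) (block t ++ l, map letter g ++ y :: r)
    (focus (block t' ++ l') r') ->
  reaches (2 * size t + size t' + size g + 4)
    (cfg (b, Compare) (focus (block t ++ l) (map letter g ++ y :: r))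
       (focus (block t' ++ l') r'))
    (cfg (b, Compare) (focus (rev (map letter g) ++ block t ++ l) (y :: r))
       (focus l' (rev (block t') ++ r'))).
1,3: move=> e; apply: (@reaches_leq (size (block t') + (size g).+1).+1);
  [by rewrite size_block; lia | apply: reaches_step; rewrite {}e];
  apply: reaches_trans (reaches_return b g (block t ++ l) r (behead l')
    (head None l') (rev (block t') ++ r') ny);
  (* [reaches_advance] needs a visible cell under the first head: a letter of [g], or else [y]. *)
  by case: g => [|? ?]; exact: reaches_advance.
  by case: s' ne => // x' s' _; apply: mismatch; rewrite step_cfg.
case: s' ne => [|x' s'] ne; first by apply: mismatch; rewrite step_cfg.
have [eqx|nex] := eqVneq x x'; last first.
  by apply: mismatch; rewrite step_cfg //= letter_eq (negbTE nex).
subst x'; apply: (@reaches_leq (2 * size s + size s' + (size g).+1 + 4).+1).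
  by rewrite /=; lia.
apply: reaches_step; rewrite step_cfg //= letter_eq eqxx /=.
rewrite eqseq_cons eqxx /= in ne.
have := IH s' (x :: g) (letter x :: r') ne.
by rewrite /= !rev_cons !cat_rcons.
Qed.

Lemma reaches_compare_eq b s l r l' r' :
  reaches (size (block s))
    (cfg (b, Compare) (focus (block s ++ l) r) (focus (block s ++ l') r'))
    (cfg (b, Skip) (focus (opener :: l) (rev (map letter s) ++ r))
       (focus (opener :: l') (rev (map letter s) ++ r'))).
Proof.
elim: s r r' => [|x s IH] r r'; apply: reaches_step; rewrite step_cfg //=.
  exact: reaches_refl.
by rewrite letter_eq eqxx /= rev_cons !cat_rcons; apply: IH.
Qed.

Lemma reaches_rewind b g l r u : None \notin g ->
  reaches (size g).+1
    (cfg (b, Rewind) (focus l r) (u, g ++ [:: None]))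
    (cfg (b, Compare) (focus l r) (focus (rev g ++ u) [:: None])).
Proof.
elim: g u => [|[c|] g IH] u //= ng; apply: reaches_step; rewrite step_cfg //=.
  exact: reaches_refl.
by rewrite rev_cons cat_rcons; apply: IH.
Qed.

Lemma reaches_skip b s g l r u : None \notin g ->
  reaches (size (block s) + (size g).+1)
    (cfg (b, Skip) (focus (block s ++ l) r) (u, g ++ [:: None]))
    (cfg (b, Compare) (focus l (rev (block s) ++ r))
       (focus (rev g ++ u) [:: None])).
Proof.
move=> ng; apply: reaches_trans (reaches_rewind _ _ _ _ ng).
case: g {ng} => [|c g];
  elim: s r => [|x s IH] r; apply: reaches_step; rewrite step_cfg //=;
  by [exact: reaches_refl | rewrite rev_cons cat_rcons; apply: IH].
Qed.

(** [G] lists the atoms already passed, [F] those still to be compared. The product in the bound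
    pays for the mismatches, each of cost linear in the two blocks; the other terms pay for the end
    of the search, with its skip and rewind. *)
Lemma reaches_search b s F G l y r : ~~ is_letter y ->
  reaches (4 * size (block s) * size (blocks F) + size (block s)
           + size (blocks (G ++ F)) + 2)
    (cfg (b, Compare) (focus (block s ++ l) (y :: r))
       (focus (blocks F ++ [:: None]) (rev (blocks G) ++ [:: None])))
    (cfg (b && (s \in F), Compare) (focus l (rev (block s) ++ y :: r))
       (focus (blocks (G ++ F) ++ [:: None]) [:: None])).
Proof.
move=> ny; elim: F G => [|s' F IH] G.
  (* The second head is on the blank that delimits its tape: no atom is left to compare. *)
  rewrite in_nil andbF cats0.
  have nG : None \notin rev (blocks G) by rewrite mem_rev None_blocks.
  have := reaches_skip false s l (y :: r) [:: None] nG.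
  rewrite revK size_rev => skipG.
  apply: (reaches_leq _ (reaches_step _)); last first.
    by case: s skipG => [|x s] skipG; rewrite step_cfg //=; exact: skipG.
  by rewrite /=; lia.
have eqGF : G ++ s' :: F = rcons G s' ++ F by rewrite cat_rcons.
have eqb : blocks (s' :: F) = block s' ++ blocks F by [].
have eqG : rev (blocks (rcons G s')) = rev (block s') ++ rev (blocks G).
  by rewrite -cats1 blocks_cat rev_cat /blocks /= cats0.
have sizeb := size_block.
rewrite in_cons eqGF eqb -catA size_cat.
have [eqs|ne] := eqVneq s s'; last first.
  apply: (reaches_leq _ (reaches_trans
    (@reaches_compare_neq b s s' [::] l y r _ _ ne ny) _)); last first.
    by rewrite /= catA -eqG; apply: IH.
  by rewrite !sizeb /=; nia.
subst s'; rewrite andbT.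
apply: (reaches_leq _ (reaches_trans
  (reaches_compare_eq b s l (y :: r) _ _) _)); last first.
  have nG : None \notin rev (blocks (rcons G s)) by rewrite mem_rev None_blocks.
  have := reaches_skip b [::] l (rev (map letter s) ++ y :: r)
    (blocks F ++ [:: None]) nG.
  by rewrite revK size_rev eqG !rev_block blocks_cat -!catA; apply.
by rewrite blocks_cat size_cat !sizeb /=; nia.
Qed.

(** * Scanning the conjunctions on the first tape *)

Definition boundary (r : seq cell) : bool :=
  if r is y :: _ then ~~ is_letter y else false.

Definition scan_start (F : seq (seq A)) : tape :=
  focus (blocks F ++ [:: None]) [:: None].

(** Every block has at least one cell, its opener, so each look-up fits in [size (block s) * (5 *
    size (blocks F) + 3)]. The opener just passed is the boundary required for the next atom. *)
Lemma reaches_atoms b F G l r : boundary r ->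
  reaches (size (blocks G) * (5 * size (blocks F) + 3))
    (cfg (b, Compare) (focus (blocks G ++ l) r) (scan_start F))
    (cfg (b && all (mem F) G, Compare) (focus l (rev (blocks G) ++ r))
       (scan_start F)).
Proof.
elim: G b r => [|s G IH] b [|y r] // ny.
  by rewrite andbT; apply: reaches_refl.
have -> : blocks (s :: G) = block s ++ blocks G by [].
rewrite rev_cat -(catA (block s)) -(catA (rev (blocks G))) (size_cat (block s)).
rewrite mulnDl [all _ (s :: G)]/= andbA.
apply: reaches_trans; last by apply: IH; rewrite rev_block.
apply: reaches_leq (reaches_search b s F [::] (blocks G ++ l) r ny).
by rewrite size_block /=; nia.
Qed.

Definition formulas (D : seq (bool * seq (seq A))) : seq cell :=
  flatten [seq blocks bF.2 ++ [:: sign bF.1] | bF <- D].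

(** The step taken on a sign is charged to the cell of that sign; the extra 1 is for the blank
    beyond the left end. The tape [t] is left open because acceptance may stop the first head at any
    negative sign. *)
Lemma reaches_formulas F D r : boundary r ->
  exists t, reaches (size (formulas D) * (5 * size (blocks F) + 3) + 1)
    (cfg (true, Compare) (focus (formulas D) r) (scan_start F))
    (cfg (has (covered F) D, Halt) t (scan_start F)).
Proof.
elim: D r => [|[b G] D IH] r br.
  by eexists; apply: reaches_step; rewrite step_cfg //=; apply: reaches_refl.
have -> : formulas ((b, G) :: D) = blocks G ++ sign b :: formulas D.
  by rewrite /formulas /= -catA.
have A1 := reaches_atoms true F G (sign b :: formulas D) br.
have [cov|ncov] := boolP (covered F (b, G)).
  eexists; apply: (reaches_leq _ (reaches_trans A1 (reaches_step _))); last first.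
    rewrite step_cfg //= andbC -[_ && _]/(covered F (b, G)) cov.
    exact: (reaches_refl 0).
  by rewrite size_cat mulnDl (mulSn (size (formulas D))); lia.
have [t Ht] := IH (sign b :: rev (blocks G) ++ r) isT.
exists t; apply: (reaches_leq _ (reaches_trans A1 (reaches_step _))); last first.
  rewrite step_cfg //= andbC -[_ && _]/(covered F (b, G)) (negbTE ncov).
  exact: Ht.
by rewrite size_cat mulnDl (mulSn (size (formulas D))); lia.
Qed.

(** * The copying phase *)

Fixpoint kept (b : bool) (w : seq (symbol A)) : seq (symbol A) :=
  match w with
  | [::] => [::]
  | inl (inl s) :: w => kept s w
  | x :: w => if b then x :: kept b w else kept b w
  end.

(** Distinct lists can denote the same tape: [z] is empty or one explicit blank, and [z'] is at most
    one cell, which the next step overwrites. *)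
Lemma reaches_copy b w l l' z z' :
    behead z = [::] -> head None z = None -> behead z' = [::] ->
  reaches (size w).+1
    (cfg (b, Copy) (l, map of_symbol w ++ z) (l', z'))
    (cfg (true, Compare) (focus (rev (map of_symbol w) ++ l) [:: None])
       (focus (rev (map of_symbol (kept b w)) ++ l') [:: None])).
Proof.
move=> z0 hz; elim: w b l l' z' => [|x w IH] b l l' z' z'0;
  apply: reaches_step; rewrite step_cfg //=.
  by rewrite /read /= hz /= /write /= z0 z'0; apply: reaches_refl.
case: x => [[s|[]]|x] /=; rewrite rev_cons cat_rcons.
- by rewrite /write /= z'0; apply: IH.
- case: b; rewrite /write /= z'0; last exact: IH.
  by rewrite rev_cons cat_rcons; apply: IH.
- case: b; rewrite /write /= z'0; last exact: IH.
  by rewrite rev_cons cat_rcons; apply: IH.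
Qed.

Lemma kept_atoms b F w :
  kept b (flatten [seq encode_atom a | a <- F] ++ w) =
  (if b then flatten [seq encode_atom a | a <- F] else [::]) ++ kept b w.
Proof.
elim: F => [|a F IH] /=; first by case: b.
rewrite -catA.
have -> (w' : seq (symbol A)) : kept b ([seq inr x | x <- a] ++ w') =
    (if b then [seq inr x | x <- a] else [::]) ++ kept b w'.
  by elim: a => [|x a IHa] /=; [case: b {IH} | rewrite IHa; case: b {IH IHa}].
by rewrite IH; case: b {IH} => //=; rewrite -catA.
Qed.

(** A nonempty encoding opens with a sign, so the initial flag is replaced before any symbol could
    be kept. *)
Lemma kept_encode b d :
  kept b (encode d) = flatten [seq encode_atom a | a <- positive_atoms d].
Proof.
elim: d b => // -[s F] d IH b.
rewrite /encode /= -/(encode d) kept_atoms IH /positive_atoms /=.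
by case: s => //=; rewrite map_cat flatten_cat.
Qed.

(** * Reversal of the encoding *)

Lemma rev_encode_atoms F :
  rev (map of_symbol (flatten [seq encode_atom a | a <- F])) =
  blocks (rev (map rev F)).
Proof.
elim: F => // a F IH.
rewrite [map rev _]/= rev_cons -cats1 blocks_cat -IH.
rewrite -[flatten _]/(encode_atom a ++ _) map_cat rev_cat; congr cat.
by rewrite /= rev_cons -cats1 -map_comp /blocks /= cats0 /block map_rev.
Qed.

Definition mirror (d : seq (bool * seq (seq A))) : seq (bool * seq (seq A)) :=
  rev [seq (bF.1, rev (map rev bF.2)) | bF <- d].

Lemma rev_encode d : rev (map of_symbol (encode d)) = formulas (mirror d).
Proof.
elim: d => // -[s F] d IH.
have -> : mirror ((s, F) :: d) = rcons (mirror d) (s, rev (map rev F)).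
  by rewrite /mirror /= rev_cons.
rewrite /formulas map_rcons flatten_rcons -/(formulas _) -IH.
rewrite /encode /= map_cat rev_cons rev_cat rev_encode_atoms rcons_cat.
by rewrite cats1.
Qed.

(** Coverage depends only on membership, which ignores order, and reversal is injective on words. *)
Lemma has_covered_mirror (P : seq (seq A)) d :
  has (covered (rev (map rev P))) (mirror d) = has (covered P) d.
Proof.
rewrite has_rev has_map; apply: eq_has => -[b F].
rewrite /covered /= all_rev all_map; congr andb; apply: eq_all => a /=.
by rewrite mem_rev mem_map //; apply: (can_inj revK).
Qed.

(** * Total running time *)

Lemma size_kept b w : size (kept b w) <= size w.
Proof. by elim: w b => // -[[s|u]|x] w IH [] /=; rewrite ?ltnS // leqW. Qed.

Lemma emptiness_machineP d :
  let n := size (encode d) in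
  answers_within EM (n * (5 * n + 3) + n + 3) (encode d)
    (has (covered (positive_atoms d)) d).
Proof.
set w := encode d; set P := rev (map rev (positive_atoms d)) => n.
(* The first step rewrites the cell that it reads, so on the empty input it leaves an explicit blank
   on the first tape. *)
pose z : seq cell := if w is [::] then [:: None] else [::].
have startP : step (init EM w) =
    cfg (false, Copy) ([::], map of_symbol w ++ z) ([:: None], [::]).
  by rewrite init_cfg step_cfg // /z; case: (w) => //= x w'; rewrite cats0.
have [z0 hz] : behead z = [::] /\ head None z = None by rewrite /z; case: (w).
have := reaches_copy false w [::] [:: None] z0 hz (erefl (behead [::])).
rewrite rev_encode kept_encode rev_encode_atoms -/P cats0 => copyP.
have [t scanP] := @reaches_formulas P (mirror d) [:: None] isT.
have leP : size (blocks P) <= n.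
  by rewrite -rev_encode_atoms -(kept_encode false) size_rev size_map size_kept.
have eqn : size (formulas (mirror d)) = n.
  by rewrite -rev_encode size_rev size_map.
rewrite eqn has_covered_mirror in scanP.
have [k kn] := reaches_trans copyP scanP.
rewrite -startP -iterSr => eqk.
(* One step for [Start], at most [n + 1] for the copy and [n * (5 * n + 3) + 1] for the scan. *)
have leN : k.+1 <= n * (5 * n + 3) + n + 3.
  have : n * (5 * size (blocks P) + 3) <= n * (5 * n + 3).
    by rewrite leq_mul // leq_add2r leq_mul.
  by move: kn; rewrite -/n; lia.
(* A halted configuration is fixed by [step], so the steps left up to the bound change nothing. *)
rewrite /answers_within -(subnK leN) iterD eqk iter_fix; first by case: has.
by rewrite /step /= !xpair_eqE; case: has.
Qed.

End EmptinessMachine.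

Theorem theorem2 (A : finType) (R : realType) :
  poly_time_decidable (@encode_instance A R)
    (fun I : class_instance A R => eq_class (true_formulas I) == set0).
Proof.
(* Coefficients come lowest degree first: [5n^2 + 4n + 3 = n(5n + 3) + n + 3]. *)
exists (emptiness_machine A), (Poly [:: 3; 4; 5]) => I.
rewrite eq_class_eq0 horner_Poly.
have := emptiness_machineP (description (true_formulas I)).
rewrite /= -/(encode_instance I); congr answers_within.
(* The conversion unfolds Horner evaluation to plain arithmetic on naturals, within reach of
   [nia]. *)
move: (size _) => n; rewrite -[RHS]/(((0 * n + 5) * n + 4) * n + 3); nia.
Qed.
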